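(* Let $P$ be a property of recursively presented marked groups that is semi-decidable from recursive presentations (i.e. $\nu_{RP}$-semi-decidable). Then there exists a computably enumerable (possibly empty) sequence of finite presentations such that a recursively presented marked group satisfies $P$ if and only if it is a marked quotient of a marked group defined by one of these presentations.
   Context: A $k$-marked group is a pair $(G,S)$ with $G$ a group and $S=(s_1,\dots,s_k)\in G^k$ a tuple generating $G$. A morphism of $k$-marked groups $(G,S)\to(H,S')$ is a group homomorphism sending $s_i$ to $s_i'$ for each $i$. Marked groups are considered up to isomorphism of marked groups. $(H,S')$ is a marked quotient of $(G,S)$ if there is a morphism $(G,S)\to(H,S')$. Groups marked by tuples of different lengths are incomparable. A property of marked groups is a set of isomorphism classes of marked groups. Let $\langle n,m\rangle$ denote a computable bijection $\mathbb{N}^2\to\mathbb{N}$ with computable inverse. Let $\mathcal{A}_n=\{x_1,\dots,x_n\}$ and let $\theta_n:\mathbb{N}\to(\mathcal{A}_n\cup\mathcal{A}_n^{-1})^*$ be a natural computable bijection, uniformly in $n\ge 1$. Let $\varphi_0,\varphi_1,\dots$ be a standard enumeration of the partial computable functions and $W_i=\mathrm{dom}(\varphi_i)$. The numbering of recursive presentations is $\nu_{RP}(\langle n,i\rangle)=\langle\mathcal{A}_n\mid\theta_n(W_i)\rangle$, marked by $(x_1,\dots,x_n)$. A marked group is recursively presented if it is in the image of $\nu_{RP}$. A set $P$ of recursively presented marked groups is $\nu_{RP}$-semi-decidable if there is a partial computable function $F$ such that for all $p\in\mathrm{dom}(\nu_{RP})$, $F(p)$ is defined if and only if $\nu_{RP}(p)\in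 P$. A finite presentation is a pair of a finite alphabet $\mathcal{A}_n$ and a finite set of words over $\mathcal{A}_n\cup\mathcal{A}_n^{-1}$, coded by a natural number in a standard way; it defines the marked group given by that presentation, marked by $(x_1,\dots,x_n)$. *)

(* Defs.v *)
(* Groups are the (possibly infinite) [groupType]s of
   boot/monoid.v, and the quotients use the classical axioms of boolp. *)
From Stdlib Require Cantor.
From HB Require Import structures.
#[warnings="-notation-overridden"]
From mathcomp Require Import all_boot generic_quotient zify.
From mathcomp Require Import boolp.

Set Implicit Arguments.
Unset Strict Implicit.
Unset Printing Implicit Defensive.

Import Algebra.

Definition npair (x y : nat) : nat := Cantor.to_nat (x, y).
Definition nfst (z : nat) : nat := (Cantor.of_nat z).1.
Definition nsnd (z : nat) : nat := (Cantor.of_nat z).2.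

Lemma npairK z : npair (nfst z) (nsnd z) = z.
Proof.
by rewrite /npair /nfst /nsnd -surjective_pairing Cantor.cancel_to_of.
Qed.

Lemma nfstK x y : nfst (npair x y) = x.
Proof. by rewrite /nfst /npair Cantor.cancel_of_to. Qed.

Lemma nsndK x y : nsnd (npair x y) = y.
Proof. by rewrite /nsnd /npair Cantor.cancel_of_to. Qed.

(* Programs for the mu-recursive functions; functions of several arguments are
   unary functions of a Cantor-paired argument. *)
Inductive prog : Type :=
| Zero | Succ | Fst | Snd
| Pair of prog & prog
| Comp of prog & prog
| Prec of prog & prog
| Mu of prog.

Fixpoint prec_graph (F G : nat -> nat -> Prop) (a n y : nat) : Prop :=
  if n is m.+1 then
    exists2 z, prec_graph F G a m z & G (npair a (npair m z)) y
  else F a y.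

(* [eval c] is the graph of the partial function computed by [c]:
     Prec f g : <a, 0>   |-> f a
                <a, m+1> |-> g <a, <m, value at <a, m>>>
     Mu f     : a |-> the least y such that f <a, y> = 0, all the previous
                      values being defined. *)
Fixpoint eval (c : prog) (x y : nat) : Prop :=
  match c with
  | Zero => y = 0
  | Succ => y = x.+1
  | Fst => y = nfst x
  | Snd => y = nsnd x
  | Pair f g => exists u v, [/\ eval f x u, eval g x v & y = npair u v]
  | Comp f g => exists2 u, eval g x u & eval f u y
  | Prec f g => prec_graph (eval f) (eval g) (nfst x) (nsnd x) y
  | Mu f => eval f (npair x y) 0 /\
            (forall m, m < y -> exists v, eval f (npair x m) v.+1)
  end.

Definition halts (c : prog) (x : nat) : Prop := exists y, eval c x y.

Lemma eval_functional c x y z : eval c x y -> eval c x z -> y = z.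
Proof.
elim: c x y z => [||||f IHf g IHg|f IHf g IHg|f IHf g IHg|f IHf] x y z /=.
- by move=> -> ->.
- by move=> -> ->.
- by move=> -> ->.
- by move=> -> ->.
- move=> [u [v [fu gv ->]]] [u' [v' [fu' gv' ->]]].
  by rewrite (IHf _ _ _ fu fu') (IHg _ _ _ gv gv').
- move=> [u gu fy] [u' gu' fz]; rewrite (IHg _ _ _ gu' gu) in fz.
  exact: IHf fy fz.
- elim: (nsnd x) y z => [|m IHm] y z /=; first exact: IHf.
  move=> [u pu gy] [u' pu' gz]; rewrite (IHm _ _ pu' pu) in gz.
  exact: IHg gy gz.
- move=> [fy ly] [fz lz]; case: (ltngtP y z) => // [ltyz|ltzy].
    by have [v fv] := lz _ ltyz; have := IHf _ _ _ fy fv.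
  by have [v fv] := ly _ ltzy; have := IHf _ _ _ fz fv.
Qed.

Fixpoint prog_num (c : prog) : nat :=
  match c with
  | Zero => 0
  | Succ => 1
  | Fst => 2
  | Snd => 3
  | Pair f g => 4 + 4 * npair (prog_num f) (prog_num g)
  | Comp f g => 5 + 4 * npair (prog_num f) (prog_num g)
  | Prec f g => 6 + 4 * npair (prog_num f) (prog_num g)
  | Mu f => 7 + 4 * prog_num f
  end.

Lemma npair_inj x y x' y' : npair x y = npair x' y' -> x = x' /\ y = y'.
Proof.
move=> e; split; first by rewrite -(nfstK x y) e nfstK.
by rewrite -(nsndK x y) e nsndK.
Qed.

Lemma prog_num_inj : injective prog_num.
Proof.
elim=> [||||f IHf g IHg|f IHf g IHg|f IHf g IHg|f IHf];
  case=> [||||f' g'|f' g'|f' g'|f'] /= e; try by [|lia].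
- by have /npair_inj[/IHf-> /IHg->] :
    npair (prog_num f) (prog_num g) = npair (prog_num f') (prog_num g') by lia.
- by have /npair_inj[/IHf-> /IHg->] :
    npair (prog_num f) (prog_num g) = npair (prog_num f') (prog_num g') by lia.
- by have /npair_inj[/IHf-> /IHg->] :
    npair (prog_num f) (prog_num g) = npair (prog_num f') (prog_num g') by lia.
- by rewrite (IHf f') //; lia.
Qed.

Lemma prog_num_surj i : exists c, prog_num c = i.
Proof.
have [n] := ubnP i; elim: n i => // n IHn i ltin.
case: (ltnP i 4) => [|le4i].
  by move: i {ltin} => [|[|[|[|//]]]] _;
    [exists Zero|exists Succ|exists Fst|exists Snd].
pose q := (i - 4) %/ 4.
have leq : nsnd q + nfst q <= q.
  apply/leP; rewrite -{3}(npairK q).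
  exact: Cantor.to_nat_non_decreasing.
have ltqi : q < i by rewrite /q; lia.
have [f ef] : exists c, prog_num c = nfst q by apply: IHn; lia.
have [g eg] : exists c, prog_num c = nsnd q by apply: IHn; lia.
have [h eh] : exists c, prog_num c = q by apply: IHn; lia.
have : (i - 4) %% 4 < 4 by rewrite ltn_mod.
case r: ((i - 4) %% 4) => [|[|[|[|//]]]] _.
- by exists (Pair f g); rewrite /= ef eg npairK /q; lia.
- by exists (Comp f g); rewrite /= ef eg npairK /q; lia.
- by exists (Prec f g); rewrite /= ef eg npairK /q; lia.
- by exists (Mu h); rewrite /= eh /q; lia.
Qed.

(* By the two lemmas above, [phi i] is the graph of the function computed by
   the unique program of number [i]. *)
Definition phi (i x y : nat) : Prop := exists2 c, prog_num c = i & eval c x y.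

Definition W (i x : nat) : Prop := exists y, phi i x y.

(* Words over x_1, ..., x_n and their inverses: [(j, false)] stands for x_(j+1)
   and [(j, true)] for its inverse. *)
Notation letter n := ('I_n * bool)%type (only parsing).
Notation word n := (seq ('I_n * bool)) (only parsing).

Definition letter_inv n (l : letter n) : letter n := (l.1, ~~ l.2).
Definition word_inv n (w : word n) : word n := rev (map (@letter_inv n) w).

(* Bijective base-2n numeration, least significant digit first; the digit
   d + 1 stands for the letter of number d. *)
Definition letter_num n (l : letter n) : nat := l.1.*2 + l.2.

Fixpoint word_num n (w : word n) : nat :=
  if w is l :: w' then (letter_num l + n.*2 * word_num w').+1 else 0.

Definition nth_letter m (d : nat) : letter m.+1 := (inord d./2, odd d).

Fixpoint theta_rec m (fuel k : nat) : word m.+1 :=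
  match fuel, k with
  | fuel'.+1, k'.+1 =>
      nth_letter m (k' %% m.+1.*2) :: theta_rec m fuel' (k' %/ m.+1.*2)
  | _, _ => [::]
  end.

(* only meaningful for [0 < n] *)
Definition theta (n : nat) : nat -> word n :=
  if n is m.+1 then fun k => theta_rec m k k else fun=> [::].

Lemma theta_recK m fuel (w : word m.+1) :
  word_num w <= fuel -> theta_rec m fuel (word_num w) = w.
Proof.
elim: w fuel => [|[j b] w IHw] [|fuel] //=; rewrite ltnS => le_fuel.
have ltl : letter_num (j, b) < m.+1.*2.
  by rewrite /letter_num /=; have := ltn_ord j; case: b {le_fuel} => /=; lia.
rewrite addnC mulnC modnMDl modn_small // divnMDl // divn_small // addn0.
congr (_ :: _); last by apply: IHw; move: le_fuel; rewrite doubleS; lia.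
rewrite /nth_letter /letter_num /= oddD odd_double oddb addFb.
by rewrite addnC half_bit_double inord_val.
Qed.

Lemma word_num_rec m fuel k :
  k <= fuel -> word_num (theta_rec m fuel k) = k.
Proof.
elim: fuel k => [|fuel IHfuel] [|k] //=; rewrite ltnS => le_fuel.
rewrite IHfuel; last exact: leq_trans (leq_div _ _) le_fuel.
have ltd : k %% m.+1.*2 < m.+1.*2 by rewrite ltn_mod.
rewrite /letter_num /nth_letter /= inordK; last by lia.
rewrite (addnC _.*2) odd_double_half {3}(divn_eq k m.+1.*2).
by rewrite addnC mulnC.
Qed.

Lemma word_numK n : 0 < n -> cancel (@word_num n) (@theta n).
Proof. by case: n => // m _ w; apply: theta_recK. Qed.

Lemma thetaK n : 0 < n -> cancel (@theta n) (@word_num n).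
Proof. by case: n => // m _ k; apply: word_num_rec. Qed.

(* The marking is a tuple, given as a sequence whose size is the number of
   marked generators. *)
Record marked_group : Type := MarkedGroup {
  mg_group :> groupType;
  marking : seq mg_group;
  mg_generated : forall H : {pred mg_group},
    group_closed H -> {subset marking <= H} -> forall x, x \in H
}.

(* Equality of sequences forces the two tuples to have the same length. *)
Definition marked_morphism (G H : marked_group) (f : {multiplicative G -> H}) :
  Prop := map f (marking G) = marking H.

Definition marked_quotient (G H : marked_group) : Prop :=
  exists f : {multiplicative G -> H}, marked_morphism f.

Definition marked_iso (G H : marked_group) : Prop :=
  exists2 f : {multiplicative G -> H}, marked_morphism f & bijective f.

Definition iso_invariant (P : marked_group -> Prop) : Prop :=
  forall G H, marked_iso G H -> P G -> P H.

(* Equality in <x_1, ..., x_n | R>: the congruence on words generated by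
   l l^-1 = 1, for every letter l, and r = 1, for every relator r. *)
Inductive pres_eq n (R : word n -> Prop) : word n -> word n -> Prop :=
| pres_eq_refl u : pres_eq R u u
| pres_eq_sym u v : pres_eq R u v -> pres_eq R v u
| pres_eq_trans u v w : pres_eq R u v -> pres_eq R v w -> pres_eq R u w
| pres_eq_cancel u l v : pres_eq R (u ++ l :: letter_inv l :: v) (u ++ v)
| pres_eq_rel u r v : R r -> pres_eq R (u ++ r ++ v) (u ++ v).

Section PresentedGroup.
Variables (n : nat) (R : word n -> Prop).
Implicit Types (u v w : word n) (l : letter n).

Lemma letter_invK : involutive (@letter_inv n).
Proof. by case=> j b; rewrite /letter_inv /= negbK. Qed.

Lemma word_inv_cons l u : word_inv (l :: u) = word_inv u ++ [:: letter_inv l].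
Proof. by rewrite /word_inv /= rev_cons -cats1. Qed.

Lemma word_inv_cat u v : word_inv (u ++ v) = word_inv v ++ word_inv u.
Proof. by rewrite /word_inv map_cat rev_cat. Qed.

Lemma word_invK : involutive (@word_inv n).
Proof.
by move=> u; rewrite /word_inv map_rev revK -map_comp map_id_in // => l _ /=;
  rewrite letter_invK.
Qed.

Lemma pres_eq_cat2 a b u v :
  pres_eq R u v -> pres_eq R (a ++ u ++ b) (a ++ v ++ b).
Proof.
elim=> {u v} [u|u v _|u v w _ IHu _|u l v|u r v Rr].
- exact: pres_eq_refl.
- exact: pres_eq_sym.
- exact: pres_eq_trans.
- rewrite -!catA /= !(catA a u); exact: pres_eq_cancel.
- rewrite -!catA !(catA a u); exact: pres_eq_rel.
Qed.

Lemma pres_eq_mul u u' v v' :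
  pres_eq R u u' -> pres_eq R v v' -> pres_eq R (u ++ v) (u' ++ v').
Proof.
move=> euu' evv'; apply: (pres_eq_trans (v := u' ++ v)).
  exact: (pres_eq_cat2 [::]).
by have := pres_eq_cat2 u' [::] evv'; rewrite !cats0.
Qed.

Lemma pres_eq_mulV u : pres_eq R (u ++ word_inv u) [::].
Proof.
elim: u => [|l u IHu]; first exact: pres_eq_refl.
rewrite word_inv_cons; apply: (pres_eq_trans (v := [:: l; letter_inv l])).
  by have := pres_eq_cat2 [:: l] [:: letter_inv l] IHu; rewrite /= -!catA.
exact: (pres_eq_cancel R [::] l [::]).
Qed.

Lemma pres_eq_Vmul u : pres_eq R (word_inv u ++ u) [::].
Proof. by have := pres_eq_mulV (word_inv u); rewrite word_invK. Qed.

Lemma pres_eq_inv u v : pres_eq R u v -> pres_eq R (word_inv u) (word_inv v).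
Proof.
move=> euv; apply: (pres_eq_trans (v := word_inv u ++ v ++ word_inv v)).
  apply: pres_eq_sym; rewrite -{2}(cats0 (word_inv u)).
  exact: pres_eq_mul (pres_eq_refl _ _) (pres_eq_mulV v).
apply: (pres_eq_trans (v := word_inv u ++ u ++ word_inv v)).
  by apply: pres_eq_cat2; apply: pres_eq_sym.
rewrite catA -{2}(cat0s (word_inv v)).
exact: pres_eq_mul (pres_eq_Vmul u) (pres_eq_refl _ _).
Qed.

Definition pres_eqb u v : bool := `[< pres_eq R u v >].

Lemma pres_eqb_refl : reflexive pres_eqb.
Proof. by move=> u; apply/asboolP/pres_eq_refl. Qed.

Lemma pres_eqb_sym : symmetric pres_eqb.
Proof. by move=> u v; apply/asboolP/asboolP; apply: pres_eq_sym. Qed.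

Lemma pres_eqb_trans : transitive pres_eqb.
Proof.
move=> v u w /asboolP euv /asboolP evw; apply/asboolP.
exact: pres_eq_trans euv evw.
Qed.

Canonical pres_equiv :=
  EquivRel pres_eqb pres_eqb_refl pres_eqb_sym pres_eqb_trans.

Definition presented : Type := {eq_quot pres_equiv}%qT.
HB.instance Definition _ := Choice.on presented.
HB.instance Definition _ := EqQuotient.on presented.

Definition pclass (u : word n) : presented := (\pi_presented u)%qT.
Definition prepr (x : presented) : word n := repr x.

Lemma preprK x : pclass (prepr x) = x.
Proof. exact: reprK. Qed.

Lemma pclassP u v : pclass u = pclass v <-> pres_eq R u v.
Proof.
split=> [e|e].
  by have /eqmodP/asboolP : (u = v %[mod presented])%qT by exact: e.
by apply/eqmodP/asboolP.
Qed.

Lemma preprP u : pres_eq R (prepr (pclass u)) u.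
Proof. by apply/pclassP; rewrite preprK. Qed.

Definition pmul (x y : presented) : presented := pclass (prepr x ++ prepr y).
Definition pone : presented := pclass [::].
Definition pinv (x : presented) : presented := pclass (word_inv (prepr x)).

Lemma pmulE u v : pmul (pclass u) (pclass v) = pclass (u ++ v).
Proof. by apply/pclassP/pres_eq_mul; apply: preprP. Qed.

Lemma pinvE u : pinv (pclass u) = pclass (word_inv u).
Proof. by apply/pclassP/pres_eq_inv/preprP. Qed.

Lemma pmulA : associative pmul.
Proof.
move=> x y z; rewrite -(preprK x) -(preprK y) -(preprK z).
by rewrite !pmulE catA.
Qed.

Lemma pmul1 : left_id pone pmul.
Proof. by move=> x; rewrite -(preprK x) pmulE. Qed.

Lemma pmulr1 : right_id pone pmul.
Proof. by move=> x; rewrite -(preprK x) pmulE cats0. Qed.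

Lemma pmulV : left_inverse pone pinv pmul.
Proof.
move=> x; rewrite -(preprK x) pinvE pmulE.
exact/pclassP/pres_eq_Vmul.
Qed.

Lemma pmulrV : right_inverse pone pinv pmul.
Proof.
move=> x; rewrite -(preprK x) pinvE pmulE.
exact/pclassP/pres_eq_mulV.
Qed.

HB.instance Definition _ :=
  isGroup.Build presented pmulA pmul1 pmulr1 pmulV pmulrV.

Definition pgens : seq presented :=
  [seq pclass [:: (j, false)] | j <- enum 'I_n].

Lemma pgens_generate (H : {pred presented}) :
  group_closed H -> {subset pgens <= H} -> forall x, x \in H.
Proof.
case=> H1 Hdiv Hgens x; rewrite -(preprK x).
have Hinv y : y \in H -> (y^-1)%g \in H.
  by move=> Hy; have := Hdiv _ _ H1 Hy; rewrite div1g.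
have Hmul y z : y \in H -> z \in H -> (y * z)%g \in H.
  by move=> Hy Hz; have := Hdiv _ _ Hy (Hinv _ Hz); rewrite invgK.
elim: (prepr x) => [|[j b] w IHw]; first exact: H1.
rewrite -[_ :: w]cat1s -pmulE; apply: Hmul => //.
have Hj : pclass [:: (j, false)] \in H.
  by apply: Hgens; apply: map_f; rewrite mem_enum.
by case: b => //; have := Hinv _ Hj; rewrite /inv /= pinvE.
Qed.

Definition presented_group : marked_group := MarkedGroup pgens_generate.

End PresentedGroup.

(* <n, i> |-> <x_1, ..., x_n | theta_n (W_i)>, whose domain is the set of the
   <n, i> with n >= 1 *)
Definition nuRP (p : nat) : option marked_group :=
  if 0 < nfst p then
    Some (presented_group
            (fun w : word (nfst p) => exists2 k, W (nsnd p) k & theta _ k = w))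
  else None.

Definition rec_presented (G : marked_group) : Prop :=
  exists p H, nuRP p = Some H /\ marked_iso H G.

Definition nuRP_semi_decidable (P : marked_group -> Prop) : Prop :=
  exists F : prog, forall p G, nuRP p = Some G -> (halts F p <-> P G).

(* The finite set of relators is given by a list of its elements. *)
Record fin_pres : Type := FinPres {
  fp_rank : nat;
  fp_rank_gt0 : 0 < fp_rank;
  fp_rels : seq (word fp_rank)
}.

Fixpoint seq_num (s : seq nat) : nat :=
  if s is a :: s' then (npair a (seq_num s')).+1 else 0.

Definition fp_num (pi : fin_pres) : nat :=
  npair (fp_rank pi) (seq_num (map (@word_num _) (fp_rels pi))).

Definition fp_group (pi : fin_pres) : marked_group :=
  presented_group (fun w => w \in fp_rels pi).

Definition computable_seq (u : nat -> fin_pres) : Prop :=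
  exists c : prog, forall j, eval c j (fp_num (u j)).

(* [L] is the set of terms of a (possibly empty) computable sequence. *)
Definition comp_enumerable (L : fin_pres -> Prop) : Prop :=
  (forall pi, ~ L pi) \/
  exists2 u, computable_seq u & forall pi, L pi <-> exists j, u j = pi.

(* Main.v *)
(* The sequence consists of the finite presentations of the groups in P; it is
   enumerated by dovetailing the program F that semi-decides P.
   That this works is a Rice-Shapiro argument.  If G in P had a quotient H
   outside P, take a presentation that lists the relators of G and adds those
   of H once F accepts that very presentation: whether F accepts it or not
   contradicts the choice of F.  If G is in P, take a presentation that lists
   the relators of G until F accepts that very presentation: F has to accept
   it, so only finitely many relators are listed and they define a group in P
   of which G is a quotient.
   Only the fixed program F and programs of given presentations are ever
   simulated, so that step-bounded interpreters of fixed programs and the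
   recursion theorem suffice, without a universal program. *)
Require Import Defs.
From HB Require Import structures.
#[warnings="-notation-overridden"]
From mathcomp Require Import all_boot zify.
From mathcomp Require Import boolp.

Set Implicit Arguments.
Unset Strict Implicit.
Unset Printing Implicit Defensive.

(** * Computable functions *)

Definition computable (f : nat -> nat) : Prop :=
  exists c, forall x, eval c x (f x).

Lemma computable_id : computable id.
Proof.
exists (Pair Fst Snd) => x /=; exists (nfst x), (nsnd x).
by rewrite npairK.
Qed.

Lemma computable_comp g f :
  computable g -> computable f -> computable (fun x => g (f x)).
Proof. by move=> [c cg] [d df]; exists (Comp c d) => x; exists (f x). Qed.

Lemma computable_succ f : computable f -> computable (fun x => (f x).+1).
Proof. by apply: computable_comp; exists Succ. Qed.

Lemma computable_fst f : computable f -> computable (fun x => nfst (f x)).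
Proof. by apply: computable_comp; exists Fst. Qed.

Lemma computable_snd f : computable f -> computable (fun x => nsnd (f x)).
Proof. by apply: computable_comp; exists Snd. Qed.

Lemma computable_pair f g :
  computable f -> computable g -> computable (fun x => npair (f x) (g x)).
Proof.
by move=> [c cf] [d dg]; exists (Pair c d) => x; exists (f x), (g x).
Qed.

Lemma computable_const k : computable (fun=> k).
Proof. by elim: k => [|k IHk]; [exists Zero|apply: computable_succ]. Qed.

(** [Prec] hands its step the parameter, the index and the accumulator as nested pairs, which is the
    shape required of [g]. All bounded loops below reduce to this case. *)
Lemma computable_iteri (n f : nat -> nat) (g : nat -> nat -> nat -> nat) :
  computable n -> computable f ->
  computable (fun w => g (nfst w) (nfst (nsnd w)) (nsnd (nsnd w))) ->
  computable (fun x => iteri (n x) (g x) (f x)).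
Proof.
move=> cn [d df] [e eg].
have [c cE] : computable (fun z => iteri (nsnd z) (g (nfst z)) (f (nfst z))).
  exists (Prec d e) => z /=; elim: (nsnd z) => [|m IHm] /=; first exact: df.
  exists (iteri m (g (nfst z)) (f (nfst z))) => //.
  by have := eg (npair (nfst z) (npair m (iteri m (g (nfst z)) (f (nfst z)))));
    rewrite !(nfstK, nsndK).
have [d' d'E] := computable_pair computable_id cn.
exists (Comp c d') => x; exists (npair x (n x)); first exact: d'E.
by have := cE (npair x (n x)); rewrite nfstK nsndK.
Qed.

Lemma computable_ext f g : f =1 g -> computable f -> computable g.
Proof. by move=> fg [c cf]; exists c => x; rewrite -fg. Qed.

Lemma computable_pred f : computable f -> computable (fun x => (f x).-1).
Proof.
move=> cf; apply: (@computable_ext (fun x => iteri (f x) (fun m _ => m) 0)).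
  by move=> x; case: (f x).
apply: (computable_iteri (g := fun _ m _ => m)) => //.
  exact: computable_const.
exact/computable_fst/computable_snd/computable_id.
Qed.

Lemma computable_add f g :
  computable f -> computable g -> computable (fun x => f x + g x).
Proof.
move=> cf cg.
apply: (@computable_ext (fun x => iteri (f x) (fun _ r => r.+1) (g x))).
  by move=> x; elim: (f x) => //= m ->.
apply: (computable_iteri (g := fun _ _ r => r.+1)) => //.
exact/computable_succ/computable_snd/computable_snd/computable_id.
Qed.

Lemma computable_sub f g :
  computable f -> computable g -> computable (fun x => f x - g x).
Proof.
move=> cf cg.
apply: (@computable_ext (fun x => iteri (g x) (fun _ r => r.-1) (f x))).
  by move=> x; elim: (g x) => [|m /= ->]; rewrite ?subn0 ?subnS.
apply: (computable_iteri (g := fun _ _ r => r.-1)) => //.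
exact/computable_pred/computable_snd/computable_snd/computable_id.
Qed.

(** The loop runs once or not at all, a boolean being the number 1 or 0. *)
Lemma computable_if (b : nat -> bool) f g :
  computable (fun x => b x) -> computable f -> computable g ->
  computable (fun x => if b x then f x else g x).
Proof.
move=> cb cf cg.
apply: (@computable_ext (fun x => iteri (b x) (fun _ _ => f x) (g x))).
  by move=> x; case: (b x).
apply: (computable_iteri (g := fun x _ _ => f x)) => //.
exact: computable_comp cf (computable_fst computable_id).
Qed.

Lemma computable_eq0 f : computable f -> computable (fun x => f x == 0).
Proof.
move=> cf; apply: (@computable_ext (fun x => 1 - f x)).
  by move=> x; case: (f x) => //= m; lia.
by apply: computable_sub => //; apply: computable_const.
Qed.

Lemma computable_neg (b : nat -> bool) :
  computable (fun x => b x) -> computable (fun x => ~~ b x).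
Proof.
by move=> cb; apply: computable_ext (computable_eq0 cb) => x; case: (b x).
Qed.

Lemma computable_and (a b : nat -> bool) :
  computable (fun x => a x) -> computable (fun x => b x) ->
  computable (fun x => a x && b x).
Proof.
move=> ca cb; apply: computable_ext (computable_if ca cb (computable_const 0)).
by move=> x; case: (a x).
Qed.

Lemma computable_or (a b : nat -> bool) :
  computable (fun x => a x) -> computable (fun x => b x) ->
  computable (fun x => a x || b x).
Proof.
move=> ca cb; apply: computable_ext (computable_if ca (computable_const 1) cb).
by move=> x; case: (a x).
Qed.

Lemma computable_eq f g :
  computable f -> computable g -> computable (fun x => f x == g x).
Proof.
move=> cf cg; apply: (@computable_ext (fun x => (f x - g x) + (g x - f x) == 0)).
  by move=> x; congr nat_of_bool; lia.
by apply/computable_eq0/computable_add; apply: computable_sub.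
Qed.

(** With 0 for [None], failure is tested by comparison with 0, and [.-1] recovers the value
    otherwise. *)
Definition ocode (o : option nat) : nat := if o is Some y then y.+1 else 0.

Lemma computable_obind (f : nat -> option nat) (g : nat -> nat -> option nat) :
  computable (fun x => ocode (f x)) ->
  computable (fun z => ocode (g (nfst z) (nsnd z))) ->
  computable (fun x => ocode (obind (g x) (f x))).
Proof.
move=> cf cg.
(* On failure the predecessor passes the junk value 0 to [g]; the conditional below discards the
   result. *)
have cgf :=
  computable_comp cg (computable_pair computable_id (computable_pred cf)).
apply: computable_ext
  (computable_if (computable_eq0 cf) (computable_const 0) cgf).
by move=> x /=; rewrite nfstK nsndK; case: (f x).
Qed.

Lemma computable_oiteri (n : nat -> nat) (f : nat -> option nat)
    (g : nat -> nat -> nat -> option nat) :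
  computable n -> computable (fun x => ocode (f x)) ->
  computable (fun w => ocode (g (nfst w) (nfst (nsnd w)) (nsnd (nsnd w)))) ->
  computable (fun x => ocode (iteri (n x) (fun m => obind (g x m)) (f x))).
Proof.
move=> cn cf cg.
(* The loop runs on codes, where failure, coded by 0, is absorbing. *)
pose h a m r := if r == 0 then 0 else ocode (g a m r.-1).
apply: (@computable_ext (fun x => iteri (n x) (h x) (ocode (f x)))).
  move=> x; elim: (n x) => //= m ->.
  by case: (iteri _ _ _).
apply: computable_iteri => //; rewrite /h.
apply: computable_if.
  exact/computable_eq0/computable_snd/computable_snd/computable_id.
  exact: computable_const.
pose q w := npair (nfst w) (npair (nfst (nsnd w)) (nsnd (nsnd w)).-1).
have cq : computable q.
  apply: computable_pair; first exact/computable_fst/computable_id.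
  apply: computable_pair; first exact/computable_fst/computable_snd/computable_id.
  exact/computable_pred/computable_snd/computable_snd/computable_id.
by apply: computable_ext (computable_comp cg cq) => w /=; rewrite /q !(nfstK, nsndK).
Qed.

(** * Step-bounded evaluation *)

(* The only bound imposed by [t] is on minimization: [t] rounds of a walk from
   [0] that stays at a zero of [f]; the final test rejects a walk that ran out
   of rounds. *)
Fixpoint run (t : nat) (c : prog) (x : nat) : option nat :=
  match c with
  | Zero => Some 0
  | Succ => Some x.+1
  | Fst => Some (nfst x)
  | Snd => Some (nsnd x)
  | Pair f g => obind (fun u => omap (npair u) (run t g x)) (run t f x)
  | Comp f g => obind (run t f) (run t g x)
  | Prec f g =>
      iteri (nsnd x)
        (fun m => obind (fun z => run t g (npair (nfst x) (npair m z))))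
        (run t f (nfst x))
  | Mu f =>
      obind (fun y => if run t f (npair x y) == Some 0 then Some y else None)
        (iteri t
          (fun _ => obind (fun y => omap (fun v => if v == 0 then y else y.+1)
                                         (run t f (npair x y)))) (Some 0))
  end.

(** Each round advances by at most one, and only past a nonzero value, so the walk stays at the
    first zero; [y <= t] says that [t] rounds suffice to reach it. *)
Lemma run_MuP t f x y :
  run t (Mu f) x = Some y <->
  [/\ y <= t, run t f (npair x y) = Some 0 &
      forall m, m < y -> exists v, run t f (npair x m) = Some v.+1].
Proof.
rewrite /=; set s := fun _ => obind _; split=> [|[le_yt fy lty]].
  have inv k z : iteri k s (Some 0) = Some z -> z <= k /\
      forall m, m < z -> exists v, run t f (npair x m) = Some v.+1.
    elim: k z => [|k IHk] z /=; first by case=> <-.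
    case e: (iteri k s (Some 0)) => [z'|//] /=.
    have [le_z'k ltz'] := IHk _ e.
    case e': (run t f (npair x z')) => [[|v]|//] /= [<-].
      by split; first exact: leqW.
    split=> // m; rewrite ltnS leq_eqVlt => /orP[/eqP-> | /ltz' //].
    by exists v.
  case e: (iteri t s (Some 0)) => [z|//] /=; case: eqP => // fz [<-].
  by have [] := inv _ _ e.
have reach k : k <= y -> iteri k s (Some 0) = Some k.
  elim: k => //= k IHk ltky; rewrite IHk ?(ltnW ltky) //=.
  by have [v ->] := lty _ ltky.
have stay k : iteri (k + y) s (Some 0) = Some y.
  by elim: k => [|k IHk]; [apply: reach|rewrite addSn /= IHk /= fy].
by rewrite -(subnK le_yt) stay /= subnK // fy eqxx.
Qed.

Lemma run_mono t t' c x y : t <= t' -> run t c x = Some y -> run t' c x = Some y.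
Proof.
move=> le_tt'; elim: c x y => [||||f IHf g IHg|f IHf g IHg|f IHf g IHg|f IHf] x y //.
- rewrite /=; case ef: (run t f x) => [u|//]; rewrite (IHf _ _ ef) /=.
  by case eg: (run t g x) => [v|//]; rewrite (IHg _ _ eg).
- rewrite /=; case eg: (run t g x) => [u|//]; rewrite (IHg _ _ eg) /=.
  exact: IHf.
- rewrite /=; elim: (nsnd x) y => [|m IHm] y /=; first exact: IHf.
  by case e: (iteri _ _ _) => [z|//] /= eg; rewrite (IHm _ e) /=; apply: IHg.
- move=> /run_MuP[le_yt fy lty]; apply/run_MuP; split; first exact: leq_trans le_tt'.
    exact: IHf.
  by move=> m /lty[v fv]; exists v; apply: IHf.
Qed.

Lemma run_eval t c x y : run t c x = Some y -> eval c x y.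
Proof.
elim: c x y => [||||f IHf g IHg|f IHf g IHg|f IHf g IHg|f IHf] x y.
- by case.
- by case.
- by case.
- by case.
- rewrite /=; case ef: (run t f x) => [u|//] /=.
  case eg: (run t g x) => [v|//] [<-]; exists u, v; split=> //.
    exact: IHf.
  exact: IHg.
- rewrite /=; case eg: (run t g x) => [u|//] /= ef; exists u; first exact: IHg.
  exact: IHf.
- rewrite /=; elim: (nsnd x) y => [|m IHm] y /=; first exact: IHf.
  case e: (iteri _ _ _) => [z|//] /= eg; exists z; first exact: IHm.
  exact: IHg.
- move=> /run_MuP[_ fy lty] /=; split; first exact: IHf.
  by move=> m /lty[v fv]; exists v; apply: IHf.
Qed.

(** Only finitely many subcomputations occur, so the maximum of their bounds serves for all of them
    by [run_mono]. *)
Lemma eval_run c x y : eval c x y -> exists t, run t c x = Some y.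
Proof.
elim: c x y => [||||f IHf g IHg|f IHf g IHg|f IHf g IHg|f IHf] x y /=.
- by move=> ->; exists 0.
- by move=> ->; exists 0.
- by move=> ->; exists 0.
- by move=> ->; exists 0.
- move=> [u [v [/IHf[t ft] /IHg[t' gt'] ->]]]; exists (maxn t t').
  by rewrite (run_mono (leq_maxl t t') ft) (run_mono (leq_maxr t t') gt').
- move=> [u /IHg[t gt] /IHf[t' ft']]; exists (maxn t t').
  rewrite (run_mono (leq_maxl t t') gt) /=.
  exact: run_mono (leq_maxr t t') ft'.
- elim: (nsnd x) y => [|m IHm] y /=; first exact: IHf.
  move=> [z /IHm[t e] /IHg[t' gt']]; exists (maxn t t').
  suff -> : iteri m (fun m => obind (fun z => run (maxn t t') g
      (npair (nfst x) (npair m z)))) (run (maxn t t') f (nfst x)) = Some z.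
    exact: run_mono (leq_maxr t t') gt'.
  (* The loop is itself a bounded run of [Prec f g], with [m] as recursion argument, so monotonicity
     applies to it as a whole. *)
  have := @run_mono t _ (Prec f g) (npair (nfst x) m) z (leq_maxl t t').
  by rewrite /= !nfstK nsndK; apply.
- move=> [/IHf[t ft] lty].
  have [t' ft'] : exists t', forall m, m < y ->
      exists v, run t' f (npair x m) = Some v.+1.
    elim: (y) lty => [|k IHk] ltk; first by exists 0.
    have [m ltmk|t' ft'] := IHk; first exact: ltk (leqW ltmk).
    have [v /IHf[t'' ft'']] := ltk _ (ltnSn k).
    exists (maxn t' t'') => m; rewrite ltnS leq_eqVlt => /orP[/eqP-> | /ft'[w fw]].
      by exists v; apply: run_mono (leq_maxr t' t'') ft''.
    by exists w; apply: run_mono (leq_maxl t' t'') fw.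
  exists (maxn y (maxn t t')); apply/run_MuP; split; first exact: leq_maxl.
    by apply: run_mono ft; lia.
  by move=> m /ft'[v fv]; exists v; apply: run_mono fv; lia.
Qed.

Definition halts_in (c : prog) (t x : nat) : bool := run t c x.

Lemma haltsP c x : halts c x <-> exists t, halts_in c t x.
Proof.
rewrite /halts_in; split=> [[y /eval_run[t e]]|[t]]; first by exists t; rewrite e.
by case e: (run t c x) => [y|//] _; exists y; apply: run_eval e.
Qed.

Lemma halts_in_mono c t t' x : t <= t' -> halts_in c t x -> halts_in c t' x.
Proof.
rewrite /halts_in => le_tt'; case e: (run t c x) => [y|//] _.
by rewrite (run_mono le_tt' e).
Qed.

(** The program [c] is fixed, so its interpreter is built by induction on its syntax. Bound and
    input are arbitrary computable functions of a context, because recursive calls enlarge the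
    context with intermediate values. *)
Lemma computable_run c t x : computable t -> computable x ->
  computable (fun w => ocode (run (t w) c (x w))).
Proof.
elim: c t x => [||||f IHf g IHg|f IHf g IHg|f IHf g IHg|f IHf] t x ct cx /=.
- exact: computable_const.
- exact: (computable_succ (computable_succ cx)).
- exact: (computable_succ (computable_fst cx)).
- exact: (computable_succ (computable_snd cx)).
- have c1 := computable_comp ct (computable_fst computable_id).
  have c2 := computable_comp cx (computable_fst computable_id).
  apply: (computable_obind (g := fun w u => omap (npair u) (run (t w) g (x w)))).
    exact: IHf.
  apply: (computable_obind (f := fun z => run (t (nfst z)) g (x (nfst z)))
    (g := fun z v => Some (npair (nsnd z) v))); first exact: IHg.
  apply/computable_succ/computable_pair; last exact/computable_snd/computable_id.
  exact/computable_snd/computable_fst/computable_id.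
- apply: (computable_obind (g := fun w => run (t w) f)); first exact: IHg.
  apply: IHf; last exact/computable_snd/computable_id.
  exact: computable_comp ct (computable_fst computable_id).
- apply: (computable_oiteri
    (g := fun w m z => run (t w) g (npair (nfst (x w)) (npair m z)))).
  + exact: computable_snd.
  + exact/IHf/computable_fst.
  apply: IHg; first exact: computable_comp ct (computable_fst computable_id).
  apply: computable_pair.
    exact: computable_fst (computable_comp cx (computable_fst computable_id)).
  by apply: computable_ext (computable_snd computable_id) => z; rewrite npairK.
- pose h w y := run (t w) f (npair (x w) y).
  have ch : computable (fun z => ocode (h (nfst z) (nsnd z))).
    apply: IHf; first exact: computable_comp ct (computable_fst computable_id).
    apply: computable_pair; last exact/computable_snd/computable_id.
    exact: computable_comp cx (computable_fst computable_id).
  apply: (computable_obind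
    (g := fun w y => if h w y == Some 0 then Some y else None)); last first.
    pose b z := ocode (h (nfst z) (nsnd z)) == 1.
    apply: (@computable_ext (fun z => if b z then (nsnd z).+1 else 0)).
      by rewrite /b => z; case: (h _ _) => [[|v]|].
    apply: computable_if; last exact: computable_const.
      by apply: computable_eq => //; apply: computable_const.
    exact/computable_succ/computable_snd/computable_id.
  apply: (computable_oiteri (g := fun w _ y =>
    omap (fun v => if v == 0 then y else y.+1) (h w y))) => //.
    exact: computable_const.
  apply: (computable_obind (f := fun w => h (nfst w) (nsnd (nsnd w)))
    (g := fun w v => let y := nsnd (nsnd w) in
                     Some (if v == 0 then y else y.+1))).
    have cq : computable (fun w => npair (nfst w) (nsnd (nsnd w))).
      apply: computable_pair; first exact/computable_fst/computable_id.
      exact/computable_snd/computable_snd/computable_id.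
    by apply: computable_ext (computable_comp ch cq) => w /=; rewrite nfstK nsndK.
  have cy : computable (fun z => nsnd (nsnd (nfst z))).
    exact/computable_snd/computable_snd/computable_fst/computable_id.
  apply/computable_succ/computable_if => //; last exact: computable_succ.
  exact/computable_eq0/computable_snd/computable_id.
Qed.

Lemma computable_halts_in c t x : computable t -> computable x ->
  computable (fun w => halts_in c (t w) (x w)).
Proof.
move=> ct cx.
apply: computable_ext (computable_neg (computable_eq0 (computable_run c ct cx))).
by move=> w; rewrite /halts_in; case: (run _ _ _).
Qed.

(** [Mu] looks for a zero of the negated test; it never gets stuck, since the test is total. *)
Lemma semidecidable_search (b : nat -> nat -> bool) :
  computable (fun z => b (nfst z) (nsnd z)) ->
  exists c, forall x, halts c x <-> exists s, b x s.
Proof.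
move=> /computable_neg[d dE]; exists (Mu d) => x.
have dE' s : eval d (npair x s) (~~ b x s).
  by have := dE (npair x s); rewrite nfstK nsndK.
split=> [[s [d0 _]]|bx].
  by exists s; have := eval_functional (dE' s) d0; case: (b x s).
case: (ex_minnP bx) => s bs min_s; exists s; split.
  by have := dE' s; rewrite bs.
move=> m ltms; exists 0; have := dE' m.
by case: (boolP (b x m)) => [/min_s|//]; rewrite leqNgt ltms.
Qed.

(** * The recursion theorem *)

Fixpoint const_prog (k : nat) : prog :=
  if k is k'.+1 then Comp Succ (const_prog k') else Zero.

Lemma eval_const k x y : eval (const_prog k) x y <-> y = k.
Proof.
elim: k y => [|k IHk] y //=; split=> [[u /IHk-> //]|->]; exists k => //.
exact/IHk.
Qed.

(** The s-m-n construction; [Pair Fst Snd] computes the identity. *)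
Definition curry_prog (c : prog) (a : nat) : prog :=
  Comp c (Pair (const_prog a) (Pair Fst Snd)).

Lemma halts_curry c a x : halts (curry_prog c a) x <-> halts c (npair a x).
Proof.
have e : eval (Pair (const_prog a) (Pair Fst Snd)) x (npair a x).
  exists a, x; split=> //; first exact/eval_const.
  by exists (nfst x), (nsnd x); rewrite npairK.
split=> [[y [u eu cy]]|[y cy]]; exists y; last by exists (npair a x).
by rewrite (eval_functional e eu).
Qed.

(** The effect of [curry_prog] on program numbers: [5 + 4 * _] numbers a [Comp] and [4 + 4 * _] a
    [Pair], so [i] is never decoded. *)
Definition curry_num (i a : nat) : nat :=
  5 + 4 * npair i
    (4 + 4 * npair (prog_num (const_prog a)) (prog_num (Pair Fst Snd))).

Lemma prog_num_curry c a : prog_num (curry_prog c a) = curry_num (prog_num c) a.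
Proof. by []. Qed.

Lemma computable_mul4 f : computable f -> computable (fun x => 4 * f x).
Proof.
move=> cf; apply: (@computable_ext (fun x => f x + f x + (f x + f x))) => [x|].
  by lia.
by do 2!apply: computable_add.
Qed.

Lemma computable_const_num : computable (fun a => prog_num (const_prog a)).
Proof.
(* Each round wraps the program in [Comp Succ], 1 being the number of [Succ]. *)
apply: (@computable_ext (fun a => iteri a (fun _ r => 5 + 4 * npair 1 r) 0)).
  by elim=> //= a ->.
apply: (computable_iteri (g := fun _ _ r => 5 + 4 * npair 1 r)).
- exact: computable_id.
- exact: computable_const.
apply: computable_add; first exact: computable_const.
apply/computable_mul4/computable_pair; first exact: computable_const.
exact/computable_snd/computable_snd/computable_id.
Qed.

Lemma computable_curry_num f g : computable f -> computable g ->
  computable (fun x => curry_num (f x) (g x)).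
Proof.
move=> cf cg; rewrite /curry_num.
apply/computable_add/computable_mul4/computable_pair => //.
  exact: computable_const.
apply/computable_add/computable_mul4/computable_pair; try exact: computable_const.
exact: computable_comp computable_const_num cg.
Qed.

(** Diagonal argument: on input [npair i x], [d'] runs [d] on [npair (curry_num i i) x]. For [i] the
    number of [d'], [curry_num i i] is the number of [d'] curried with [i]. *)
Lemma kleene_recursion d :
  exists c, forall x, halts c x <-> halts d (npair (prog_num c) x).
Proof.
have [e eE] : computable
    (fun z => npair (curry_num (nfst z) (nfst z)) (nsnd z)).
  apply: computable_pair; last exact/computable_snd/computable_id.
  by apply: computable_curry_num; apply/computable_fst/computable_id.
pose d' := Comp d e; exists (curry_prog d' (prog_num d')) => x.
rewrite halts_curry prog_num_curry.
have := eE (npair (prog_num d') x); rewrite nfstK nsndK => ex.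
split=> [[y [u eu dy]]|[y dy]]; exists y; last first.
  by exists (npair (curry_num (prog_num d') (prog_num d')) x).
by rewrite (eval_functional ex eu).
Qed.

(** The form in which self-reference is used: the search made by [c] may depend on the number of
    [c]. *)
Lemma self_referential_search (b : nat -> nat -> nat -> bool) :
  computable (fun w => b (nfst w) (nfst (nsnd w)) (nsnd (nsnd w))) ->
  exists c, forall x, halts c x <-> exists s, b (prog_num c) x s.
Proof.
move=> cb.
have cq : computable (fun z => npair (nfst (nfst z)) (npair (nsnd (nfst z)) (nsnd z))).
  apply/computable_pair; first exact/computable_fst/computable_fst/computable_id.
  apply/computable_pair/computable_snd/computable_id.
  exact/computable_snd/computable_fst/computable_id.
have [|d dE] := @semidecidable_search (fun v s => b (nfst v) (nsnd v) s).
  by apply: computable_ext (computable_comp cb cq) => z /=; rewrite !(nfstK, nsndK).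
have [c cE] := kleene_recursion d; exists c => x.
by rewrite cE dE nfstK nsndK.
Qed.

(** * Marked groups *)

Lemma iso_quotient (G H : marked_group) : marked_iso G H -> marked_quotient G H.
Proof. by case=> f fm _; exists f. Qed.

Lemma iso_quotientV (G H : marked_group) : marked_iso G H -> marked_quotient H G.
Proof.
case=> f fm [g fK gK].
pose gM := isMultiplicative.Build H G g (can2_gmulfM fK gK).
pose g' : {multiplicative H -> G} := HB.pack g gM.
exists g'; rewrite /marked_morphism -fm -map_comp -[RHS]map_id.
by apply: eq_map => x; apply: fK.
Qed.

Lemma marked_quotient_trans (H G K : marked_group) :
  marked_quotient G H -> marked_quotient H K -> marked_quotient G K.
Proof.
move=> [f fm] [g gm]; exists (g \o f : {multiplicative G -> K}).
by rewrite /marked_morphism map_comp fm gm.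
Qed.

Lemma multiplicative1 (G H : groupType) (f : {multiplicative G -> H}) :
  f 1%g = 1%g.
Proof. by apply: (mulgI (f 1%g)); rewrite -gmulfM !mulg1. Qed.

Lemma multiplicativeV (G H : groupType) (f : {multiplicative G -> H}) x :
  f x^-1%g = ((f x)^-1)%g.
Proof.
by apply: (mulgI (f x)); rewrite -gmulfM !mulgV multiplicative1.
Qed.

(** The fixed points of [f] form a subgroup that contains the marking. *)
Lemma marked_endo_id (G : marked_group) (f : {multiplicative G -> G}) :
  marked_morphism f -> f =1 id.
Proof.
move=> fm x; apply/eqP.
apply: (@mg_generated G [pred y | f y == y]) => [|y /(nthP 1%g)[i lti <-]].
  split; first by rewrite inE (multiplicative1 f).
  by move=> y z /eqP fy /eqP fz; rewrite inE gmulfM multiplicativeV fy fz.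
by rewrite inE -(nth_map _ 1%g) // fm.
Qed.

(** Both composites are marked endomorphisms, hence identities. *)
Lemma marked_quotient_antisym (G H : marked_group) :
  marked_quotient G H -> marked_quotient H G -> marked_iso G H.
Proof.
move=> [f fm] [g gm]; exists f => //; exists g.
  apply: (marked_endo_id (f := g \o f : {multiplicative G -> G})).
  by rewrite /marked_morphism map_comp fm gm.
apply: (marked_endo_id (f := f \o g : {multiplicative H -> H})).
by rewrite /marked_morphism map_comp gm fm.
Qed.

Lemma marked_iso_sym (G H : marked_group) : marked_iso G H -> marked_iso H G.
Proof.
by move=> e; apply: marked_quotient_antisym;
  [apply: iso_quotientV|apply: iso_quotient].
Qed.

(** * Quotients between presented groups *)

Lemma pres_eq_mono n (R R' : word n -> Prop) u v :
  (forall r, R r -> pres_eq R' r [::]) -> pres_eq R u v -> pres_eq R' u v.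
Proof.
move=> RR'; elim=> {u v} [u|u v _|u v w _ IHu _|u l v|u r v /RR' e].
- exact: pres_eq_refl.
- exact: pres_eq_sym.
- exact: pres_eq_trans.
- exact: pres_eq_cancel.
- exact: (pres_eq_cat2 u v e).
Qed.

(** Sending the class of a word to the class of the same word is well defined, since the relators of
    [R] are consequences of those of [R']. *)
Lemma presented_quotient n (R R' : word n -> Prop) :
  (forall r, R r -> pres_eq R' r [::]) ->
  marked_quotient (presented_group R) (presented_group R').
Proof.
move=> RR'; pose f (x : presented R) : presented R' := pclass R' (prepr x).
have fE w : f (pclass R w) = pclass R' w.
  by apply/pclassP/(pres_eq_mono RR')/preprP.
have fM : {morph f : x y / (x * y)%g}.
  move=> x y; rewrite -(preprK x) -(preprK y).
  by rewrite [in LHS]/mul /= pmulE !fE -pmulE.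
pose f' : {multiplicative presented R -> presented R'} :=
  HB.pack f (isMultiplicative.Build (presented R) (presented R') f fM).
exists f'; rewrite /marked_morphism /= /pgens -map_comp.
by apply: eq_map => j /=; apply: fE.
Qed.

(** The marking forces [f] on generators, so the class of each word goes to the class of the same
    word; a relator has trivial class in the source. *)
Lemma presented_quotient_rel n (R R' : word n -> Prop) r :
  marked_quotient (presented_group R) (presented_group R') ->
  R r -> pres_eq R' r [::].
Proof.
move=> [f fm] Rr.
have fgen j : f (pclass R [:: (j, false)]) = pclass R' [:: (j, false)].
  move: fm; rewrite /marked_morphism /= /pgens -map_comp => /eq_in_map.
  by apply; rewrite mem_enum.
have fM x y : f (pmul x y) = pmul (f x) (f y) := gmulfM x y.
have fE w : f (pclass R w) = pclass R' w.
  elim: w => [|[j b] w IHw]; first exact: (multiplicative1 f).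
  rewrite -[_ :: w]cat1s -!pmulE fM IHw; congr (pmul _ _).
  case: b => //.
  rewrite (_ : pclass R [:: (j, true)] =
    (pclass R [:: (j, false)] : presented R)^-1)%g.
    by rewrite (multiplicativeV f) fgen /inv /= pinvE.
  by rewrite /inv /= pinvE.
apply/pclassP; rewrite -!fE; congr (f _); apply/pclassP.
by have := pres_eq_rel [::] [::] Rr; rewrite cats0.
Qed.

Lemma presented_quotient_rank n m (R : word n -> Prop) (R' : word m -> Prop) :
  marked_quotient (presented_group R) (presented_group R') -> n = m.
Proof.
have sz k (Q : word k -> Prop) : size (pgens Q) = k.
  by rewrite size_map size_enum_ord.
by move=> [f /(congr1 size)]; rewrite size_map /= !sz.
Qed.

(** For [0 < n] these are exactly the values of [nuRP], with a program in place of its number and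
    words identified with their numbers. *)
Definition rp_group (n : nat) (c : prog) : marked_group :=
  presented_group (fun w : word n => halts c (word_num w)).

Lemma WP c k : W (prog_num c) k <-> halts c k.
Proof.
split=> [[y [d /prog_num_inj-> dy]]|[y cy]]; first by exists y.
by exists y, c.
Qed.

Lemma nuRP_rp_group n c : 0 < n ->
  nuRP (npair n (prog_num c)) = Some (rp_group n c).
Proof.
move=> n0; rewrite /nuRP nfstK nsndK n0 /rp_group.
congr (Some (presented_group _)); apply/funext => w; apply/propext.
split=> [[k /WP ck <-]|cw]; first by rewrite thetaK.
by exists (word_num w); [apply/WP|apply: word_numK].
Qed.

Lemma rec_presentedP G :
  rec_presented G -> exists n c, 0 < n /\ marked_iso (rp_group n c) G.
Proof.
move=> [p [H [pH HG]]]; move: pH; rewrite -(npairK p).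
have [c <-] := prog_num_surj (nsnd p).
case: (posnP (nfst p)) => [->|n0]; first by rewrite /nuRP nfstK.
by rewrite nuRP_rp_group // => -[eH]; exists (nfst p), c; rewrite eH.
Qed.

(** * Codes of finite presentations *)

(** [nsnd s.-1] is the code of the tail; past the end the code stays at 0, which the first conjunct
    rejects. *)
Definition seq_num_at (S k x : nat) : bool :=
  let S' := iter k (fun s => nsnd s.-1) S in (S' != 0) && (nfst S'.-1 == x).

Lemma seq_num_atP s x : x \in s <-> exists k, seq_num_at (seq_num s) k x.
Proof.
rewrite /seq_num_at; elim: s => [|a s IHs].
  split=> // -[k].
  by have -> : iter k (fun s => nsnd s.-1) 0 = 0 by elim: k => //= k ->.
rewrite inE; split=> [/orP[/eqP-> | /IHs[k ks]]|[[|k]]].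
- by exists 0; rewrite /= nfstK.
- by exists k.+1; rewrite iterSr /= nsndK.
- by rewrite /= nfstK => /eqP->; rewrite eqxx.
- by rewrite iterSr /= nsndK => ks; apply/orP; right; apply/IHs; exists k.
Qed.

Lemma computable_seq_num_at f g h :
  computable f -> computable g -> computable h ->
  computable (fun z => seq_num_at (f z) (g z) (h z)).
Proof.
move=> cf cg ch; rewrite /seq_num_at.
pose q z := iteri (g z) (fun _ s => nsnd s.-1) (f z).
have cq : computable q.
  apply: (computable_iteri (g := fun _ _ s => nsnd s.-1)) => //.
  exact/computable_snd/computable_pred/computable_snd/computable_snd/computable_id.
apply: (@computable_ext (fun z => (q z != 0) && (nfst (q z).-1 == h z))) => //.
apply: computable_and; first exact/computable_neg/computable_eq0.
by apply: computable_eq => //; apply/computable_fst/computable_pred.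
Qed.

Lemma seq_num_inj : injective seq_num.
Proof.
elim=> [|a s IHs] [|b t] //= [] /npair_inj[-> /IHs->] //.
Qed.

Lemma seq_num_surj S : exists s, seq_num s = S.
Proof.
have [n] := ubnP S; elim: n S => // n IHn [|S] ltSn; first by exists [::].
have [|s es] := IHn (nsnd S); last by exists (nfst S :: s); rewrite /= es npairK.
have /leP := Cantor.to_nat_non_decreasing (nfst S) (nsnd S).
by rewrite -/(npair _ _) npairK; lia.
Qed.

Lemma fp_num_inj : injective fp_num.
Proof.
case=> n n0 rs [m m0 rs'] /npair_inj[/= e]; subst m.
move=> /seq_num_inj/(inj_map (can_inj (word_numK n0)))->.
by rewrite (eq_irrelevance n0 m0).
Qed.

Lemma fp_num_surj z : 0 < nfst z -> exists pi, fp_num pi = z.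
Proof.
move=> n0; have [s es] := seq_num_surj (nsnd z).
exists (FinPres n0 (map (@theta _) s)).
rewrite /fp_num /= -map_comp map_id_in ?es ?npairK // => k _ /=.
exact: thetaK.
Qed.

Lemma fp_group_rp pi c :
  (forall x, halts c x <-> x \in map (@word_num _) (fp_rels pi)) ->
  fp_group pi = rp_group (fp_rank pi) c.
Proof.
move=> cP; congr presented_group; apply/funext => w; apply/propext.
by rewrite cP (mem_map (can_inj (word_numK (fp_rank_gt0 pi)))).
Qed.

(** Finite presentations become recursive ones effectively: one program [d] searches a coded list
    for its input, and currying supplies the list of relators. *)
Lemma fp_index : exists2 idx, computable idx &
  forall pi, exists2 c, fp_group pi = rp_group (fp_rank pi) c &
    idx (fp_num pi) = npair (fp_rank pi) (prog_num c).
Proof.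
have [|d dE] := @semidecidable_search (fun z k => seq_num_at (nfst z) k (nsnd z)).
  apply: computable_seq_num_at; first exact/computable_fst/computable_fst/computable_id.
    exact/computable_snd/computable_id.
  exact/computable_snd/computable_fst/computable_id.
exists (fun j => npair (nfst j) (curry_num (prog_num d) (nsnd j))).
  apply: computable_pair; first exact/computable_fst/computable_id.
  apply: computable_curry_num; first exact: computable_const.
  exact/computable_snd/computable_id.
move=> pi; pose S := seq_num (map (@word_num _) (fp_rels pi)).
exists (curry_prog d S); last by rewrite prog_num_curry /fp_num nfstK nsndK.
by apply: fp_group_rp => x; rewrite halts_curry dE nfstK nsndK seq_num_atP.
Qed.

(** * Semi-decidable properties *)

Section SemiDecidable.
Variables (P : marked_group -> Prop) (F : prog).
Hypothesis P_inv : iso_invariant P.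
Hypothesis FP : forall n c, 0 < n ->
  (halts F (npair n (prog_num c)) <-> P (rp_group n c)).

(* The program [c] enumerates the relators of [a], and those of [g] once [F]
   accepts the presentation given by [c] itself. *)
Lemma semi_decidable_quotient n a g : 0 < n ->
  marked_quotient (rp_group n a) (rp_group n g) ->
  P (rp_group n a) -> P (rp_group n g).
Proof.
move=> n0 ag Pa; apply: contrapT => nPg.
pose b i x s := halts_in a s x ||
                (halts_in F s (npair n i) && halts_in g s x).
have [|c cE] := @self_referential_search b.
  have cs := computable_snd (computable_snd computable_id).
  have cx := computable_fst (computable_snd computable_id).
  have ci := computable_fst computable_id.
  apply: computable_or; first exact: computable_halts_in.
  apply: computable_and; last exact: computable_halts_in.
  apply: computable_halts_in => //; apply: computable_pair => //.
  exact: computable_const.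
have [Fc|nFc] := pselect (halts F (npair n (prog_num c))).
  (* On acceptance [c] lists the relators of both [a] and [g]; those of [a] already hold in the
     group of [g], so [c] presents that group. *)
  apply: nPg; apply: P_inv (iffLR (FP c n0) Fc).
  apply: marked_quotient_antisym; apply: presented_quotient => r.
    move=> /cE[s /orP[ar|/andP[_ gr]]].
      by apply: (presented_quotient_rel ag); apply/haltsP; exists s.
    rewrite -[r]cats0; apply: (@pres_eq_rel _ _ [::]).
    by apply/haltsP; exists s.
  move=> /haltsP[s gr]; rewrite -[r]cats0; apply: (@pres_eq_rel _ _ [::]).
  have /haltsP[t Ft] := Fc; apply/cE; exists (maxn s t); apply/orP; right.
  by rewrite (halts_in_mono (leq_maxr s t) Ft) (halts_in_mono (leq_maxl s t) gr).
(* Without acceptance [c] lists exactly the relators of [a], so [F] has to accept it. *)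
case: (nFc); apply/(FP c n0); rewrite (_ : rp_group n c = rp_group n a) //.
congr presented_group; apply/funext => w; apply/propext; rewrite cE haltsP.
split=> -[s]; last by exists s; apply/orP; left.
case/orP => [aw|/andP[Fs _]]; first by exists s.
by case: nFc; apply/haltsP; exists s.
Qed.

(* The program [c] enumerates the relators of [g] only as long as [F] has not
   accepted the presentation given by [c] itself. *)
Lemma semi_decidable_compact n g : 0 < n -> P (rp_group n g) ->
  exists2 pi, P (fp_group pi) & marked_quotient (fp_group pi) (rp_group n g).
Proof.
move=> n0 Pg.
(* The bound [x + s] ensures that, once [F] accepts with bound [t], only numbers [x] below [t] can
   be listed, whatever [s] is. *)
pose b i x s := halts_in g s x && ~~ halts_in F (x + s) (npair n i).
have [|c cE] := @self_referential_search b.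
  have cs := computable_snd (computable_snd computable_id).
  have cx := computable_fst (computable_snd computable_id).
  have ci := computable_fst computable_id.
  apply: computable_and; first exact: computable_halts_in.
  apply/computable_neg/computable_halts_in; first exact: computable_add.
  by apply: computable_pair => //; apply: computable_const.
have Pc : P (rp_group n c).
  (* If [F] never accepted, [c] would list all relators of [g] and present a group in [P]. *)
  apply: contrapT => nPc; case: (nPc).
  rewrite (_ : rp_group n c = rp_group n g) //.
  congr presented_group; apply/funext => w; apply/propext; rewrite cE haltsP.
  split=> -[s]; first by case/andP; exists s.
  move=> gw; exists s; rewrite /b gw /=; apply/negP => Fs.
  by apply: nPc; apply/(FP c n0)/haltsP; eexists; apply: Fs.
have /(FP c n0)/haltsP[t Ft] := Pc.
(* Only the existence of the finite list is claimed, so halting is tested classically. *)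
pose rs := [seq theta n k | k <- iota 0 t & `[< halts c k >]].
have e : fp_group (FinPres n0 rs) = rp_group n c.
  apply: fp_group_rp => x; rewrite /= -map_comp map_id_in; last first.
    by move=> k _ /=; apply: thetaK.
  rewrite mem_filter mem_iota /=; split=> [cx|/andP[/asboolP]//].
  apply/andP; split; first exact/asboolP.
  have [s /andP[_ nFs]] := iffLR (cE x) cx; rewrite ltnNge; apply/negP => le_tx.
  by move/negP: nFs; apply; apply: halts_in_mono Ft; lia.
exists (FinPres n0 rs); rewrite e //; apply: presented_quotient => r.
move=> /cE[s /andP[gr _]]; rewrite -[r]cats0; apply: (@pres_eq_rel _ _ [::]).
by apply/haltsP; exists s.
Qed.

(** Dovetailing over pairs of a code and a stage: a pair that yields nothing repeats a known member
    [pi0], and without any member the sequence is empty. *)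
Lemma fin_pres_enumerable : comp_enumerable (fun pi => P (fp_group pi)).
Proof.
have [[pi0 Ppi0]|nP] := pselect (exists pi, P (fp_group pi)); last first.
  by left=> pi Ppi; apply: nP; exists pi.
right; have [idx cidx idxE] := fp_index.
have FL pi : halts F (idx (fp_num pi)) <-> P (fp_group pi).
  by have [c -> ->] := idxE pi; apply: FP; apply: fp_rank_gt0.
(* The first test discards numbers of rank 0, which code no presentation. *)
pose b z := (nfst (nfst z) != 0) && halts_in F (nsnd z) (idx (nfst z)).
pose h z := if b z then nfst z else fp_num pi0.
(* The terms are picked by choice, but [fp_num] is injective, so the computable [h] determines
   them. *)
have [|u uE] := @choice _ _ (fun z pi => fp_num pi = h z).
  move=> z; apply: fp_num_surj; rewrite /h; case: ifP => [/andP[]|_].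
    by rewrite lt0n.
  by rewrite /fp_num nfstK fp_rank_gt0.
have cfst := computable_fst computable_id.
exists u.
  have [c cE] : computable h.
    apply: computable_if => //; last exact: computable_const.
    apply: computable_and; first exact/computable_neg/computable_eq0/computable_fst.
    apply: computable_halts_in; first exact/computable_snd/computable_id.
    exact: computable_comp cidx cfst.
  by exists c => j; rewrite uE.
move=> pi; split=> [/FL/haltsP[t Ft]|[z <-]].
  exists (npair (fp_num pi) t); apply: fp_num_inj.
  rewrite uE /h /b nfstK nsndK Ft andbT ifT //.
  by rewrite /fp_num nfstK -lt0n fp_rank_gt0.
have := uE z; rewrite /h; case: ifP => [/andP[_ Fz] e|_ /fp_num_inj-> //].
by apply/FL/haltsP; exists (nsnd z); rewrite e.
Qed.

End SemiDecidable.

Theorem theorem4 (P : marked_group -> Prop)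
  (P_inv : iso_invariant P)
  (P_rp : forall G, P G -> rec_presented G)
  (P_sd : nuRP_semi_decidable P) :
  exists2 L : fin_pres -> Prop,
    comp_enumerable L &
    forall G, rec_presented G ->
      (P G <-> exists2 pi, L pi & marked_quotient (fp_group pi) G).
Proof.
have [F FE] := P_sd.
have FP n c : 0 < n -> (halts F (npair n (prog_num c)) <-> P (rp_group n c)).
  by move=> n0; apply/FE/nuRP_rp_group.
exists (fun pi => P (fp_group pi)); first exact: fin_pres_enumerable FP.
move=> G /rec_presentedP[n [g [n0 gG]]]; split=> [PG|[pi Ppi piG]].
  have Pg := P_inv _ _ (marked_iso_sym gG) PG.
  have [pi Ppi pig] := semi_decidable_compact FP n0 Pg.
  by exists pi => //; apply: marked_quotient_trans pig (iso_quotient gG).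
apply: (P_inv _ _ gG).
have pig := marked_quotient_trans piG (iso_quotientV gG).
(* Both presentations have the same alphabet; the finite one is then read as a recursive one, so
   that closure under quotients applies. *)
have en := presented_quotient_rank pig; subst n.
have [idx _ /(_ pi)[a ea _]] := fp_index; rewrite ea in Ppi pig.
exact (semi_decidable_quotient P_inv FP n0 pig Ppi).
Qed.
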